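(* Let $\Sigma$ be a finite alphabet, let $u,v\in\Sigma^\star$ and $n\in\mathbb{N}$. If $u\equiv^2_{|\Sigma|+1,n}v$, then $u\equiv^2_n v$.
   Context: Words are finite structures with universe $\{1,\dots,|w|\}$, unary predicates $Q_a$ ($a\in\Sigma$) marking the positions carrying $a$, and the order $<$. $\mathrm{FO}^2_n[<]$ is first-order logic over this signature using only the two variables $x,y$, with quantifier depth at most $n$; $\mathrm{FO}^2_{m,n}[<]$ is the set of formulas of $\mathrm{FO}^2_n[<]$ in which every path in the parse tree has at most $m$ blocks of alternating quantifiers. $u\equiv^2_n v$ (resp. $u\equiv^2_{m,n}v$) means $u$ and $v$ satisfy the same sentences of $\mathrm{FO}^2_n[<]$ (resp. $\mathrm{FO}^2_{m,n}[<]$). *)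

(* Defs.v *)
From HB Require Import structures.
From mathcomp Require Import all_boot.
Set Implicit Arguments. Unset Strict Implicit. Unset Printing Implicit Defensive.

Inductive var := VX | VY.
Definition var_eqb (a b : var) : bool :=
  match a, b with VX, VX | VY, VY => true | _, _ => false end.
Lemma var_eqP : Equality.axiom var_eqb.
Proof. by case; case; constructor. Qed.
HB.instance Definition _ := hasDecEq.Build var var_eqP.

Inductive form (Sigma : Type) :=
  | FTrue | FFalse
  | FLetter of Sigma & var | FNLetter of Sigma & var
  | FLt of var & var | FNLt of var & var
  | FEq of var & var | FNEq of var & var
  | FAnd of form Sigma & form Sigma | FOr of form Sigma & form Sigma
  | FEx of var & form Sigma | FAll of var & form Sigma.
Arguments FTrue {Sigma}. Arguments FFalse {Sigma}.

(* Assignments: values of x and y (positions are 0 .. |w|-1, order-isomorphic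
   to the paper's 1 .. |w|). *)
Definition asg := (nat * nat)%type.
Definition getv (s : asg) (z : var) : nat := if z is VX then s.1 else s.2.
Definition setv (s : asg) (z : var) (i : nat) : asg :=
  if z is VX then (i, s.2) else (s.1, i).

Fixpoint sat (Sigma : eqType) (w : seq Sigma) (s : asg) (f : form Sigma) : Prop :=
  match f with
  | FTrue => True
  | FFalse => False
  | FLetter a z => onth w (getv s z) = Some a
  | FNLetter a z => ~ (onth w (getv s z) = Some a)
  | FLt z z' => getv s z < getv s z'
  | FNLt z z' => ~ (getv s z < getv s z')
  | FEq z z' => getv s z = getv s z'
  | FNEq z z' => getv s z <> getv s z'
  | FAnd f g => sat w s f /\ sat w s g
  | FOr f g => sat w s f \/ sat w s g
  | FEx z f => exists i, i < size w /\ sat w (setv s z i) f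
  | FAll z f => forall i, i < size w -> sat w (setv s z i) f
  end.

Fixpoint free_in (Sigma : Type) (v : var) (f : form Sigma) : bool :=
  match f with
  | FTrue | FFalse => false
  | FLetter _ z | FNLetter _ z => z == v :> var
  | FLt z z' | FNLt z z' | FEq z z' | FNEq z z' => (z == v :> var) || (z' == v :> var)
  | FAnd f g | FOr f g => free_in v f || free_in v g
  | FEx z f | FAll z f => (z != v :> var) && free_in v f
  end.

Definition sentence (Sigma : Type) (f : form Sigma) : bool :=
  ~~ free_in VX f && ~~ free_in VY f.

Fixpoint qdepth (Sigma : Type) (f : form Sigma) : nat :=
  match f with
  | FAnd f g | FOr f g => maxn (qdepth f) (qdepth g)
  | FEx _ f | FAll _ f => (qdepth f).+1
  | _ => 0
  end.

(* Maximal number of blocks of alternating quantifiers along a path of the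
   parse tree, given the kind of the last quantifier met above
   (None: none yet; Some true: existential; Some false: universal). *)
Fixpoint nblocks (Sigma : Type) (q : option bool) (f : form Sigma) : nat :=
  match f with
  | FAnd f g | FOr f g => maxn (nblocks q f) (nblocks q g)
  | FEx _ f => (q != Some true) + nblocks (Some true) f
  | FAll _ f => (q != Some false) + nblocks (Some false) f
  | _ => 0
  end.

(* Truth of a sentence (the assignment is irrelevant for sentences). *)
Definition models (Sigma : eqType) (w : seq Sigma) (f : form Sigma) : Prop :=
  sat w (0, 0) f.

Definition fo2_equiv (Sigma : eqType) (n : nat) (u v : seq Sigma) : Prop :=
  forall f : form Sigma, sentence f -> qdepth f <= n ->
    (models u f <-> models v f).

Definition fo2_alt_equiv (Sigma : eqType) (m n : nat) (u v : seq Sigma) : Prop :=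
  forall f : form Sigma, sentence f -> qdepth f <= n -> nblocks None f <= m ->
    (models u f <-> models v f).

(* Main.v *)
Require Import Defs.
From mathcomp Require Import all_boot zify.
From Stdlib Require Import Classical.
Set Implicit Arguments. Unset Strict Implicit. Unset Printing Implicit Defensive.

(** A ranker is a sequence of moves "to the nearest [a] on the right/left",
    performed from the ends of a word; it breaks up into blocks of moves in the
    same direction.  Comparing a position with a ranker of [m] blocks and length
    [n] takes a two-variable formula with [m] quantifier blocks and depth [n].
    Conversely, if two words agree on the definedness of rankers of length at
    most [n], and on the order of such a ranker and a shorter one, Duplicator
    wins the [n]-round two-pebble game.

    It remains to see that [|Sigma|] blocks suffice.  A move that reaches or
    jumps over a position visited earlier can be shortened to start there.  If no
    move does so, then after the last move of each block, from [q] to [p] on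
    letter [a], the ranker stays strictly between [q] and [p], where [a] does not
    occur; so the last letters of the blocks are pairwise distinct.  Agreement on
    rankers with [|Sigma| + 1] blocks ensures that the shortenings are valid in
    both words simultaneously. *)

(** * Order along a direction *)

Definition ltd (d : bool) (p i : nat) : bool := if d then p < i else i < p.

Definition ltp (d : bool) (p : option nat) (i : nat) : bool :=
  if p is Some q then ltd d q i else true.

(** Strict and weak comparisons are treated together, since negating one reverses the direction and
    exchanges the two kinds; see [ordd_neg]. *)
Definition ordd (d st : bool) (p i : nat) : bool :=
  if st then ltd d p i else ~~ ltd d i p.

Ltac ord_lia :=
  rewrite /ordd /ltd /=;
  repeat match goal with
  | H : is_true (ltd _ _ _) |- _ => rewrite /ltd in H
  | H : is_true (~~ ltd _ _ _) |- _ => rewrite /ltd in H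
  | b : bool |- _ => destruct b
  end; simpl in *; lia.

Lemma ltdN d p i : ltd (~~ d) p i = ltd d i p.
Proof. by case: d. Qed.

Lemma ltd_trans d p q i : ltd d p q -> ltd d q i -> ltd d p i.
Proof. move=> h1 h2; ord_lia. Qed.

Lemma nltd_ltd_trans d p q i : ~~ ltd d q p -> ltd d q i -> ltd d p i.
Proof. move=> h1 h2; ord_lia. Qed.

Lemma ltd_nltd_trans d p q i : ltd d p q -> ~~ ltd d i q -> ltd d p i.
Proof. move=> h1 h2; ord_lia. Qed.

Lemma nltdd d p : ~~ ltd d p p.
Proof. ord_lia. Qed.

Lemma ltd_total d p q : p <> q -> ~~ ltd d p q -> ltd d q p.
Proof. move=> h1 h2; ord_lia. Qed.

Lemma ltd_antisym d p q : ~~ ltd d p q -> ~~ ltd d q p -> p = q.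
Proof. move=> h1 h2; ord_lia. Qed.

Lemma ordd_trans d st p q i : ~~ ltd d q p -> ordd d st q i -> ordd d st p i.
Proof. case: d; case: st; rewrite /ordd /ltd; lia. Qed.

Lemma ordd_neg d st p i : ordd (~~ d) (~~ st) p i = ~~ ordd d st p i.
Proof. case: d; case: st; rewrite /ordd /ltd /=; lia. Qed.

Lemma nearest (d : bool) (N : nat) (P : nat -> Prop) :
  (forall i, P i -> i < N) -> (exists i, P i) ->
  exists i, P i /\ forall j, P j -> ~~ ltd d j i.
Proof.
move=> bP [i0 Pi0].
have {Pi0} := Pi0; have [m] := ubnP (if d then i0 else N - i0).
elim: m i0 => // m IH i0 lem Pi0.
case: (classic (exists j, P j /\ ltd d j i0)) => [[j [Pj ltj]]|no].
  apply: (IH j) => //; move: (bP _ Pj) (bP _ Pi0) lem ltj.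
  by rewrite /ltd; case: d {IH}; lia.
exists i0; split=> // j Pj; apply/negP => ltj; apply: no; by exists j.
Qed.

(** * Rankers, their evaluation and their blocks *)

Section Rankers.
Variable Sigma : finType.
Implicit Types (w : seq Sigma) (a b c : Sigma).

(* The head of the list is the LAST step of the ranker; [true] steps to the
   right, [false] to the left. *)
Definition ranker := seq (bool * Sigma).
Implicit Types r t rho sigma tau : ranker.

Definition first w d a (p : option nat) : option nat :=
  omap val [pick i : 'I_(size w) |
    [&& onth w i == Some a, ltp d p i &
     [forall j : 'I_(size w),
        (onth w j == Some a) && ltp d p j ==> ~~ ltd d j i]]].

(* [None]: undefined; [Some None]: the empty ranker, which stands before both
   ends of the word; [Some (Some i)]: position [i]. *)
Fixpoint ev w r : option (option nat) :=
  if r is (d, a) :: r' then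
    if ev w r' is Some p then omap Some (first w d a p) else None
  else Some None.

Lemma onth_Some_lt w i a : onth w i = Some a -> i < size w.
Proof.
by elim: w i => [|b w IH] [|i] //=; rewrite ltnS; apply: IH.
Qed.

Lemma onth_lt_Some w i : i < size w -> exists a, onth w i = Some a.
Proof.
elim: w i => [|b w IH] [|i] //=; first by exists b.
by rewrite ltnS; apply: IH.
Qed.

Lemma first_Some w d a p i : first w d a p = Some i ->
  [/\ onth w i = Some a, ltp d p i &
   forall j, onth w j = Some a -> ltp d p j -> ~~ ltd d j i].
Proof.
rewrite /first; case: pickP => [x /and3P [/eqP ha hp /forallP hx] [<-]|//].
split=> // j hj pj; have := hx (Ordinal (onth_Some_lt hj)).
by rewrite /= hj eqxx pj.
Qed.

Lemma first_None w d a p j : onth w j = Some a -> ltp d p j ->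
  first w d a p <> None.
Proof.
move=> hj pj; rewrite /first; case: pickP => //= none.
pose P i := onth w i = Some a /\ ltp d p i.
have [i [[hi pi] mi]] := @nearest d (size w) P
  (fun i h => onth_Some_lt h.1) (ex_intro P j (conj hj pj)).
have := none (Ordinal (onth_Some_lt hi)); rewrite /= hi eqxx pi /=.
move/forallP; case=> x; apply/implyP => /andP [/eqP hx px].
exact: mi.
Qed.

Lemma ev_cons w d a r x : ev w ((d, a) :: r) = Some x ->
  exists p i, [/\ ev w r = Some p, x = Some i, onth w i = Some a, ltp d p i &
   forall j, onth w j = Some a -> ltp d p j -> ~~ ltd d j i].
Proof.
rewrite /=; case: (ev w r) => // p; case E: first => [i|] //= [<-].
by have [h1 h2 h3] := first_Some E; exists p, i.
Qed.

Lemma ev_defined w d a r p j : ev w r = Some p -> onth w j = Some a ->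
  ltp d p j -> exists i, ev w ((d, a) :: r) = Some (Some i).
Proof.
move=> /= -> hj pj; case E: first => [i|] /=; first by exists i.
by have := first_None hj pj.
Qed.

Lemma ev_intro w d a r p i : ev w r = Some p -> onth w i = Some a ->
  ltp d p i -> (forall j, onth w j = Some a -> ltp d p j -> ~~ ltd d j i) ->
  ev w ((d, a) :: r) = Some (Some i).
Proof.
move=> er hi pi mi; have [j ej] := ev_defined er hi pi.
rewrite ej; have [q [k [eq' [<-] hk qk mk]]] := ev_cons ej.
move: eq' qk mk; rewrite er => -[<-] qk mk.
congr (Some (Some _)); apply: (@ltd_antisym d); [exact: mi|exact: mk].
Qed.

Lemma ev_cat w t r r' : ev w r = ev w r' -> ev w (t ++ r) = ev w (t ++ r').
Proof. by move=> e; elim: t => [|[d a] t IH] //=; rewrite IH. Qed.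

Lemma ev_cat_defined w t r x :
  ev w (t ++ r) = Some x -> exists y, ev w r = Some y.
Proof.
elim: t x => [|[d a] t IH] x /=; first by exists x.
by case: (ev w (t ++ r)) IH => // p /(_ _ erefl) [y ->] _; exists y.
Qed.

Lemma ev_position w r p : ev w r = Some p -> r <> [::] ->
  exists i, p = Some i.
Proof. by case: r => [|[d a] r] // /ev_cons [q [i [_ -> _ _ _]]]; exists i. Qed.

(** Here [d] is the direction of the move that follows [r], so that a turn between [r] and that move
    counts too. *)
Fixpoint turns d r : nat :=
  if r is (d', _) :: r' then (d' != d) + turns d' r' else 0.

Definition nb r : nat := if r is (d, _) :: r' then (turns d r').+1 else 0.

Lemma turns_le_nb d r : turns d r <= nb r.
Proof. by case: r => [|[d' a] r] //=; case: eqP; lia. Qed.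

Lemma nb_cons_le d a r : nb ((d, a) :: r) <= (nb r).+1.
Proof. by rewrite /= ltnS turns_le_nb. Qed.

Lemma nb_cons d a r : nb r <= nb ((d, a) :: r).
Proof. by case: r => [|[d' b] r] //=; case: (d' == d) => /=; lia. Qed.

Lemma nb_cat t r : nb r <= nb (t ++ r).
Proof.
elim: t => [|[d a] t IH] //; apply: leq_trans IH _; exact: nb_cons.
Qed.

Lemma turns_cons_le d e a r : turns d r <= turns d ((e, a) :: r).
Proof.
case: r => [|[f b] r] //=; rewrite addnA leq_add2r.
by case: d; case: e; case: f.
Qed.

Lemma turns_cat d (s : ranker) r : turns d r <= turns d (s ++ r).
Proof.
elim: s d => [|[e a] s IH] d //; apply: leq_trans (turns_cons_le d e a r) _.
by rewrite /= leq_add2l.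
Qed.

(** If the two moves brought together by dropping [s] differ in direction, a turn already occurred
    on the way through [s]. *)
Lemma nb_cat_drop t (s : ranker) r : nb (t ++ r) <= nb (t ++ s ++ r).
Proof.
case: t => [|[d a] t]; first exact: nb_cat.
rewrite /= ltnS; elim: t d => [|[e b] t IH] d; first exact: turns_cat.
by rewrite /= leq_add2l.
Qed.

(** * Rankers in two-variable logic *)

Fixpoint neg (f : form Sigma) : form Sigma :=
  match f with
  | FTrue => FFalse
  | FFalse => FTrue
  | FLetter a z => FNLetter a z
  | FNLetter a z => FLetter a z
  | FLt z z' => FNLt _ z z'
  | FNLt z z' => FLt _ z z'
  | FEq z z' => FNEq _ z z'
  | FNEq z z' => FEq _ z z'
  | FAnd f g => FOr (neg f) (neg g)
  | FOr f g => FAnd (neg f) (neg g)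
  | FEx z f => FAll z (neg f)
  | FAll z f => FEx z (neg f)
  end.

Lemma sat_neg w s f : sat w s (neg f) <-> ~ sat w s f.
Proof.
elim: f s => [||a z|a z|z z'|z z'|z z'|z z'|f IHf g IHg|f IHf g IHg
  |z f IH|z f IH] s /=; try tauto.
- by rewrite IHf IHg; tauto.
- by rewrite IHf IHg; tauto.
- split=> [h [i [lti hf]]|h i lti].
    by move/IH: (h i lti); apply.
  by apply/IH => hf; apply: h; exists i.
- split=> [[i [lti nf]] h|h].
    by move/IH: nf; apply; apply: h.
  apply: NNPP => no; apply: h => i lti; apply: NNPP => nf; apply: no.
  by exists i; split=> //; apply/IH.
Qed.

Lemma qdepth_neg f : qdepth (neg f) = qdepth f.
Proof. by elim: f => //= [f -> g ->|f -> g ->|_ f ->|_ f ->]. Qed.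

Lemma free_in_neg z f : free_in z (neg f) = free_in z f.
Proof. by elim: f => //= [f -> g ->|f -> g ->|x f ->|x f ->]. Qed.

Lemma nblocks_neg q f : nblocks q (neg f) = nblocks (omap negb q) f.
Proof.
elim: f q => //= [f IHf g IHg q|f IHf g IHg q|_ f IHf q|_ f IHf q].
- by rewrite IHf IHg.
- by rewrite IHf IHg.
- by rewrite IHf; case: q => [[]|].
- by rewrite IHf; case: q => [[]|].
Qed.

Definition other (z : var) : var := if z is VX then VY else VX.

Definition ordF (d st : bool) (z z' : var) : form Sigma :=
  match d, st with
  | true, true => FLt _ z z'
  | true, false => FNLt _ z' z
  | false, true => FLt _ z' z
  | false, false => FNLt _ z z'
  end.

Lemma sat_ordF w s d st z z' :
  sat w s (ordF d st z z') <-> ordd d st (getv s z) (getv s z').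
Proof. by case: d; case: st => //=; split=> /negP. Qed.

Definition near d a st z (f : form Sigma) : form Sigma :=
  FEx (other z) (FAnd (FAnd (ordF d st (other z) z) (FLetter a (other z))) f).

(** If the last move goes in direction [d], any [a] beyond the rest of the ranker may serve as
    witness, as the nearest one comes no later. If it goes the other way, the complementary
    comparison is negated, so that a turn costs exactly one quantifier alternation. The two
    variables are reused in turn. *)
Fixpoint past r d st z : form Sigma :=
  if r is (d', a) :: r' then
    let near' st' := near d' a st' z (past r' d' true (other z)) in
    if d == d' then near' st else neg (near' (~~ st))
  else FTrue.

Lemma getv_other s z i : getv (setv s (other z) i) z = getv s z.
Proof. by case: z. Qed.

Lemma getv_set s z i : getv (setv s z i) z = i.
Proof. by case: z. Qed.

Lemma sat_past w s r d st z p : ev w r = Some p ->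
  sat w s (past r d st z) <->
  (if p is Some q then ordd d st q (getv s z) else true).
Proof.
elim: r d st z s p => [|[d' a] r IH] d st z s p; first by move=> /= [<-].
move=> /ev_cons [q [i [er -> hi qi mi]]].
have sat_near st' : sat w s (near d' a st' z (past r d' true (other z))) <->
    ordd d' st' i (getv s z).
  split=> [[j [ltj [[/sat_ordF h1 h2] /(IH _ _ _ _ _ er)]]]|h].
    rewrite !getv_set getv_other in h1 h2 * => h3.
    by apply: ordd_trans h1; apply: mi => //; case: (q) h3.
  exists i; split; first exact: onth_Some_lt hi.
  split; first (split; first (apply/sat_ordF)); rewrite /= ?getv_set ?getv_other //.
  by apply/(IH _ _ _ _ _ er); rewrite getv_set; case: (q) qi.
have -> : past ((d', a) :: r) d st z =
    if d == d' then near d' a st z (past r d' true (other z))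
    else neg (near d' a (~~ st) z (past r d' true (other z))) by [].
case: eqP => [->|ne]; first exact: sat_near.
rewrite sat_neg sat_near.
have -> : d = ~~ d' by move: ne; case: (d); case: (d').
have := ordd_neg d' (~~ st) i (getv s z); rewrite negbK => ->.
by split=> /negP.
Qed.

Lemma qdepth_past r d st z : qdepth (past r d st z) = size r.
Proof.
elim: r d st z => [|[d' a] r IH] d st z //=.
by case: eqP => _ /=; rewrite ?qdepth_neg IH; case: d' => //=;
   case: st => /=; rewrite ?max0n.
Qed.

(** Below an existential quantifier, [near] continues the current block, while its negation opens a
    universal one; [nblocks_neg] makes the two situations symmetric. *)
Lemma nblocks_past r d st z : nblocks (Some true) (past r d st z) = turns d r.
Proof.
elim: r d st z => [|[d' a] r IH] d st z //=.
rewrite eq_sym; case: eqP => [e|ne] /=; rewrite ?nblocks_neg /= IH.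
  by case: (d'); case: st => /=; rewrite ?max0n.
by case: (d'); case: st => /=; rewrite ?max0n.
Qed.

Lemma free_in_past r d st z : ~~ free_in (other z) (past r d st z).
Proof.
elim: r d st z => [|[d' a] r IH] d st z //=.
by case: eqP => _ /=; rewrite ?free_in_neg eqxx.
Qed.

End Rankers.

(** * Comparing rankers by sentences *)

Section Sentences.
Variable Sigma : finType.
Implicit Types (u v w : seq Sigma) (r : ranker Sigma).

Definition definedF d (a : Sigma) r : form Sigma :=
  FEx VX (FAnd (FLetter a VX) (past r d true VX)).

Definition compareF d (a : Sigma) r r' st : form Sigma :=
  FEx VX (FAnd (FLetter a VX) (FAnd (past r d true VX) (past r' (~~ d) st VX))).

Lemma models_definedF w d a r p : ev w r = Some p ->
  models w (definedF d a r) <-> ev w ((d, a) :: r) <> None.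
Proof.
move=> er; split=> [[i [lti [/= hi /(sat_past _ _ _ _ er)]]] | h].
  move=> pi; have [|j] := @ev_defined _ w d a r p i er hi; last by rewrite /= => ->.
  by case: (p) pi.
case E: (ev w ((d, a) :: r)) h => [x|] // _.
have [q [i [er' _ hi qi _]]] := ev_cons E.
move: er'; rewrite er => -[epq]; subst q.
exists i; split; first exact: onth_Some_lt hi.
by split=> //; apply/(sat_past _ _ _ _ er); case: (p) qi.
Qed.

(** The nearest [a] beyond [r] is the best candidate: if some [a] beyond [r] is on the required side
    of [j], so is [i], which lies no further on. *)
Lemma models_compareF w d a r r' st i j :
  ev w ((d, a) :: r) = Some (Some i) -> ev w r' = Some (Some j) ->
  models w (compareF d a r r' st) <-> ordd (~~ d) st j i.
Proof.
move=> er er'; have [p [x [ep [<-] hi pi mi]]] := ev_cons er; split.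
  move=> [y [lty [/= hy [/(sat_past _ _ _ _ ep) py]]]].
  move/(sat_past _ _ _ _ er') => /=.
  have : ~~ ltd d y i by apply: mi => //; case: (p) py.
  by rewrite /ordd /ltd; case: (d); case: (st) => /=; lia.
move=> h; exists i; split; first exact: onth_Some_lt hi.
split=> //; split.
  by apply/(sat_past _ _ _ _ ep); case: (p) pi.
by apply/(sat_past _ _ _ _ er').
Qed.

Definition sameord (i i' j j' : nat) : bool :=
  ((i < i') == (j < j')) && ((i' < i) == (j' < j)).

Lemma sameord_ltd d i i' j j' :
  sameord i i' j j' -> ltd d i i' = ltd d j j'.
Proof. by rewrite /sameord /ltd; case: d; lia. Qed.

Lemma sameordC i i' j j' : sameord i i' j j' = sameord i' i j' j.
Proof. by rewrite /sameord andbC. Qed.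

Lemma sameord_swap i i' j j' : sameord i i' j j' = sameord j j' i i'.
Proof. by rewrite /sameord; congr (_ && _); rewrite eq_sym. Qed.

Lemma ltd_sameord d i i' j j' : ltd d i i' -> ltd d j j' -> sameord i i' j j'.
Proof. by rewrite /sameord /ltd; case: d; lia. Qed.

(** Induction on the ranker, because [sat_past] gives [past r] its meaning only where [r] is
    defined. *)
Lemma alt_equiv_defined u v K n r : fo2_alt_equiv K n u v ->
  size r <= n -> nb r <= K -> isSome (ev u r) = isSome (ev v r).
Proof.
move=> H; elim: r => [|[d a] r IH] // sr nr.
have {IH} : isSome (ev u r) = isSome (ev v r).
  by apply: IH; [exact: ltnW | exact: leq_trans (nb_cons d a r) nr].
case Eu: (ev u r) => [p|]; case Ev: (ev v r) => [q|] //= _;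
  last by rewrite Eu Ev.
have h : models u (definedF d a r) <-> models v (definedF d a r).
  apply: H.
  - by rewrite /sentence /= (negbTE (free_in_past r d true VX)).
  - by rewrite /= qdepth_past max0n.
  - by rewrite /= nblocks_past max0n.
have := iff_trans (iff_sym (models_definedF d a Eu))
  (iff_trans h (models_definedF d a Ev)).
rewrite /= Eu Ev.
by case: first => [x|]; case: first => [y|] //= [h1 h2]; [case: h1|case: h2].
Qed.

(** The strict bounds on [r'] pay for the outer quantifier of [compareF], which comes on top of all
    of [past r']; for [r] that quantifier stands for its last move. *)
Lemma alt_equiv_ord u v K n r r' i i' j j' : fo2_alt_equiv K n u v ->
  size r <= n -> nb r <= K -> size r' < n -> nb r' < K ->
  ev u r = Some (Some i) -> ev u r' = Some (Some i') ->
  ev v r = Some (Some j) -> ev v r' = Some (Some j') ->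
  sameord i i' j j'.
Proof.
move=> H; case: r => [|[d a] r] //= sr nr sr' nr' ei ei' ej ej'.
have cmp st : ordd (~~ d) st i' i = ordd (~~ d) st j' j.
  have h : models u (compareF d a r r' st) <-> models v (compareF d a r r' st).
    apply: H.
    - by rewrite /sentence /= (negbTE (free_in_past r d true VX))
        (negbTE (free_in_past r' (~~ d) st VX)).
    - by rewrite /= !qdepth_past max0n gtn_max sr.
    - rewrite /= !nblocks_past max0n add1n gtn_max nr /=.
      exact: leq_ltn_trans (turns_le_nb _ _) nr'.
  have [h1 h2] := iff_trans (iff_sym (models_compareF st ei ei'))
    (iff_trans h (models_compareF st ej ej')).
  by apply/idP/idP.
move: (cmp true) (cmp false).
by rewrite /ordd /sameord /ltd; case: (d) => /=; lia.
Qed.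

(** * Bounding the number of blocks *)

(* Some step of [r] reaches or jumps over a position visited earlier, by a
   prefix [rho] with at most [k] blocks: it could have started from there. *)
Definition crossing w (k : nat) r : Prop :=
  exists tau d a sigma rho p p' p'',
    [/\ r = tau ++ (d, a) :: sigma ++ rho, nb rho <= k,
        [/\ ev w (sigma ++ rho) = Some (Some p), ev w rho = Some (Some p') &
            ev w ((d, a) :: sigma ++ rho) = Some (Some p'')],
        ltd d p p' & ~~ ltd d p'' p'].

(** Induction on [tau], from the turn onwards. A move in direction [d] that reached or passed [p],
    or an opposite one that reached or passed [q], would be a crossing, with [(d, a) :: r'] or [r']
    as the earlier ranker. The turn after [(d, a)] leaves these at most [k] blocks. If [r'] is
    empty, the side of [q] is unbounded. *)
Lemma nested w k r tau0 tau e b d a r' q p x :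
  ~ crossing w k r -> nb r <= k.+1 ->
  r = tau0 ++ tau ++ (e, b) :: (d, a) :: r' -> e <> d ->
  ev w r' = Some q -> ev w ((d, a) :: r') = Some (Some p) ->
  ev w (tau ++ (e, b) :: (d, a) :: r') = Some (Some x) ->
  ltp d q x /\ ltd d x p.
Proof.
move=> nc nr er ned eq ep.
have ee : e = ~~ d by case: (e) ned; case: (d).
have nbp : nb ((d, a) :: r') <= k.
  have : nb ((e, b) :: (d, a) :: r') <= nb r.
    by rewrite er catA; apply: nb_cat.
  by move: nr; rewrite /= ee; case: (d) => /=; lia.
have nbq : nb r' <= k by apply: leq_trans (nb_cons d a r') nbp.
elim: tau tau0 x er => [|[f c] tau IH] tau0 x er ex.
  have [p0 [x0 [ep0 [ex0] _ px _]]] := ev_cons ex.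
  move: ep0 ex0 px; rewrite ep => -[<-] <-; rewrite /= ee ltdN => px.
  split=> //; case: q eq => [q|] //= eq.
  have [p1 [x1 [ep1 [ex1] _ qp _]]] := ev_cons ep.
  move: ep1 ex1 qp; rewrite eq => -[<-] <- /= qp.
  apply/negPn/negP => nqx; apply: nc.
  exists tau0, e, b, [:: (d, a)], r', p, q, x; split=> //.
    by rewrite ee ltdN.
  by rewrite ee ltdN.
have [y0 [x0 [ey [ex0] _ yx _]]] := ev_cons ex.
have ny : tau ++ (e, b) :: (d, a) :: r' <> [::] by case: (tau).
have [y ey0] := ev_position ey ny.
move: ex0 ey0 yx => <- ey0; subst y0 => /= yx {x0}.
have ertau : r = rcons tau0 (f, c) ++ tau ++ (e, b) :: (d, a) :: r'.
  by rewrite cat_rcons.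
have [qy yp] := IH _ _ ertau ey.
case: (eqVneq f d) => [efd|nfd]; [subst f; split|].
- by case: (q) qy => //= q0 q0y; apply: ltd_trans q0y yx.
- apply/negPn/negP => nxp; apply: nc.
  exists tau0, d, c, (rcons tau (e, b)), ((d, a) :: r'), y, p, x.
  by rewrite !cat_rcons.
have ef : f = ~~ d by case: (f) nfd; case: (d).
move: yx; rewrite ef ltdN => xy; split; last exact: ltd_trans xy yp.
case: q eq qy {IH} => [q|] //= eq qy.
apply/negPn/negP => nqx; apply: nc.
exists tau0, f, c, (tau ++ [:: (e, b); (d, a)]), r', y, q, x.
have -> : (tau ++ [:: (e, b); (d, a)]) ++ r' = tau ++ (e, b) :: (d, a) :: r'.
  by rewrite -catA.
by split=> //; rewrite ef ltdN.
Qed.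

(** These letters belong to the moves followed by a turn, that is, to the last moves of blocks; a
    block that continues in direction [d] after [r] contributes nothing. *)
Fixpoint turn_letters d r : seq Sigma :=
  if r is (d', a) :: r' then
    if d' == d then turn_letters d' r' else a :: turn_letters d' r'
  else [::].

Lemma size_turn_letters d r : size (turn_letters d r) = turns d r.
Proof. by elim: r d => [|[d' a] r IH] d //=; case: eqP; rewrite /= IH. Qed.

Lemma mem_turn_letters d b r a : a \in turn_letters d r ->
  exists tau e c d' r', (d, b) :: r = tau ++ (e, c) :: (d', a) :: r' /\ e <> d'.
Proof.
elim: r d b => [|[d' b'] r IH] d b //=; case: eqP => [->|ne].
  move=> /(IH d b') [tau [e [c [d1 [r1 [-> h]]]]]].
  by exists ((d, b) :: tau), e, c, d1, r1.
rewrite inE => /orP [/eqP ->|/(IH d' b') [tau [e [c [d1 [r1 [-> h]]]]]]].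
  by exists [::], d, b, d', r; split=> // /esym.
by exists ((d, b) :: tau), e, c, d1, r1.
Qed.

(** By [nested], repeating the letter of an earlier turning move would lead beyond the start of that
    move and strictly before its end, although that end was the nearest such letter. *)
Lemma uniq_turn_letters w k r tau d a r' x :
  ~ crossing w k r -> nb r <= k.+1 -> ev w r = Some x ->
  r = tau ++ (d, a) :: r' -> uniq (a :: turn_letters d r').
Proof.
move=> nc nr ex; elim: r' tau d a => [|[d' a'] r' IH] tau d a er //.
have uIH : uniq (a' :: turn_letters d' r').
  by apply: (IH (rcons tau (d, a))); rewrite cat_rcons.
rewrite cons_uniq; apply/andP; split; last first.
  by rewrite /=; case: eqP => // _; case/andP: uIH.
apply/negP => /(mem_turn_letters a) [sg [e [c [d1 [r1 [ed ne]]]]]].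
move: ex; rewrite er => /ev_cat_defined [y ey].
have [p [i [_ ey' hi _ _]]] := ev_cons ey; subst y.
have [y1 /ev_cons [y2 [_ [ey2 _ _ _ _]]]] : exists y1,
    ev w ((e, c) :: (d1, a) :: r1) = Some y1.
  by move: ey; rewrite ed => /ev_cat_defined.
have [q [j [eq ej hj qj mj]]] := ev_cons ey2; subst y2.
have eyi : ev w (sg ++ (e, c) :: (d1, a) :: r1) = Some (Some i) by rewrite -ed.
have ers : r = tau ++ sg ++ (e, c) :: (d1, a) :: r1 by rewrite -ed.
have [qi ij] := nested nc nr ers ne eq ey2 eyi.
by move: (mj _ hi qi); rewrite ij.
Qed.

Lemma nb_le_card w k r x : ~ crossing w k r -> nb r <= k.+1 ->
  ev w r = Some x -> nb r <= #|Sigma|.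
Proof.
case: r => [|[d a] r] // nc nr ex.
have := uniq_turn_letters (tau := [::]) nc nr ex erefl.
have -> : nb ((d, a) :: r) = size (a :: turn_letters d r).
  by rewrite /= size_turn_letters.
by move/card_uniqP => <-; apply: max_card.
Qed.

(** As [p'] lies between [p] and [p''], starting later from [p'] discards no [a] that could be
    nearer than [p'']. *)
Lemma ev_shortcut w d a sigma rho p p' p'' :
  ev w (sigma ++ rho) = Some (Some p) -> ev w rho = Some (Some p') ->
  ev w ((d, a) :: sigma ++ rho) = Some (Some p'') ->
  ltd d p p' -> ltd d p' p'' ->
  ev w ((d, a) :: rho) = ev w ((d, a) :: sigma ++ rho).
Proof.
move=> ep ep' ep'' pp' p'p''; rewrite ep''.
have [q [i [eq [<-] hi _ mi]]] := ev_cons ep''.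
move: eq mi; rewrite ep => -[<-] mi.
apply: (ev_intro ep') => // j hj /= p'j; apply: mi => //=.
exact: ltd_trans pp' p'j.
Qed.

Section Reduction.
Variables (u v : seq Sigma) (n : nat).
Hypothesis H : fo2_alt_equiv #|Sigma|.+1 n u v.

(** A crossing found in [u] is transferred to [v]: comparing [rho], of at most [#|Sigma|] blocks,
    with the rankers before and after the crossing move yields the same order in [v]. The same cut
    is then valid in both words, and induction on the length applies. *)
Lemma reduce_blocks m r x : size r < m -> size r <= n ->
  nb r <= #|Sigma|.+1 -> ev u r = Some x ->
  exists r', [/\ size r' <= size r, nb r' <= #|Sigma|,
    ev u r' = ev u r & ev v r' = ev v r].
Proof.
elim: m r x => // m IH r x sm sn nr ex.
case: (classic (crossing u #|Sigma| r)) => [|nc]; last first.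
  by exists r; split=> //; apply: nb_le_card nc nr ex.
move=> [tau [d [a [sg [rho [p [p' [p'' [er nrho [ep ep' ep''] pp' p'p'']]]]]]]]].
have szr : size r = size tau + (size sg + size rho).+1.
  by rewrite er size_cat /= size_cat.
(* The positions [p] and [p'] differ, so cutting [sg] really shortens the ranker. *)
have sg0 : 0 < size sg.
  case: (sg) ep => //=; rewrite ep' => -[epp'].
  by move: pp'; rewrite epp' (negbTE (nltdd _ _)).
have nb1 : nb ((d, a) :: sg ++ rho) <= nb r by rewrite er; apply: nb_cat.
have nb2 : nb (sg ++ rho) <= nb r by apply: leq_trans (nb_cons d a _) nb1.
have [y ey] : exists y, ev v r = Some y.
  have := alt_equiv_defined H sn nr; rewrite ex.
  by case: (ev v r) => // y _; exists y.
have [q1 eq''] : exists y, ev v ((d, a) :: sg ++ rho) = Some y.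
  by move: ey; rewrite er => /ev_cat_defined.
have [q2 [q0 [eq eq1 _ _ _]]] := ev_cons eq''; subst q1.
have ne1 : sg ++ rho <> [::] by case: (sg) sg0.
have [q eq2] := ev_position eq ne1; subst q2.
have [q3 eq'] := ev_cat_defined eq.
have ne2 : rho <> [::] by move=> e0; move: ep'; rewrite e0.
have [q' eq3] := ev_position eq' ne2; subst q3.
have so1 : sameord p p' q q'.
  by apply: (alt_equiv_ord H _ _ _ _ ep ep' eq eq'); rewrite ?size_cat; lia.
have so2 : sameord p'' p' q0 q'.
  by apply: (alt_equiv_ord H _ _ _ _ ep'' ep' eq'' eq');
    rewrite /= ?size_cat; [lia|apply: leq_trans nb1 nr|lia|].
(* A move landing exactly on the earlier position is dropped together with [sg]; otherwise only [sg]
   is cut. *)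
case: (eqVneq p'' p') => [e|ne].
  have e' : q0 = q' by move: so2; rewrite /sameord e; lia.
  have [||||r' [s1 n1 e1 e2]] := IH (tau ++ rho) x.
  - by move: sm; rewrite szr size_cat; lia.
  - by move: sn; rewrite szr size_cat; lia.
  - apply: leq_trans nr; rewrite er.
    exact: (nb_cat_drop tau ((d, a) :: sg) rho).
  - rewrite -ex er; apply: ev_cat; by rewrite ep'' ep' e.
  exists r'; split=> //.
  - by apply: leq_trans s1 _; rewrite szr size_cat; lia.
  - by rewrite e1 er; apply: ev_cat; rewrite ep'' ep' e.
  - by rewrite e2 er; apply: ev_cat; rewrite eq'' eq' e'.
have lu : ltd d p' p'' by apply: ltd_total p'p''; apply/eqP.
have lv : ltd d q' q0 by rewrite -(sameord_ltd d (i := p') (i' := p'')) // sameordC.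
have qq' : ltd d q q' by rewrite -(sameord_ltd d so1).
have su := ev_shortcut ep ep' ep'' pp' lu.
have sv := ev_shortcut eq eq' eq'' qq' lv.
have [||||r' [s1 n1 e1 e2]] := IH (tau ++ (d, a) :: rho) x.
- by move: sm; rewrite szr size_cat /=; lia.
- by move: sn; rewrite szr size_cat /=; lia.
- apply: leq_trans nr; rewrite er -!cat_rcons.
  exact: (nb_cat_drop (rcons tau (d, a)) sg rho).
- by rewrite -ex er; apply: ev_cat.
exists r'; split=> //.
- by apply: leq_trans s1 _; rewrite szr size_cat /=; lia.
- by rewrite e1 er; apply: ev_cat.
- by rewrite e2 er; apply: ev_cat.
Qed.

(** Arbitrarily many blocks are handled one move at a time: a reduced ranker followed by one more
    move has at most [#|Sigma| + 1] blocks and falls under [reduce_blocks] again. *)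
Lemma few_blocks r : size r <= n ->
  (ev u r = None /\ ev v r = None) \/
  exists r', [/\ size r' <= size r, nb r' <= #|Sigma|,
    ev u r' = ev u r, ev v r' = ev v r & isSome (ev u r) && isSome (ev v r)].
Proof.
elim: r => [|[d a] r IH] sr; first by right; exists [::].
case: IH => [|[eu ev0]|[r' [s1 n1 eu ev0 _]]]; first exact: ltnW.
  by left; rewrite /= eu ev0.
have eu' : ev u ((d, a) :: r') = ev u ((d, a) :: r) := ev_cat [:: (d, a)] eu.
have ev' : ev v ((d, a) :: r') = ev v ((d, a) :: r) := ev_cat [:: (d, a)] ev0.
have s2 : size ((d, a) :: r') <= n by apply: leq_trans sr.
have n2 : nb ((d, a) :: r') <= #|Sigma|.+1.
  by apply: leq_trans (nb_cons_le d a r') _.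
have := alt_equiv_defined H s2 n2; rewrite -eu' -ev'.
case E: (ev u _) => [x|]; case F: (ev v _) => [y|] // _; last by left.
have [r'' [s3 n3 e3 f3]] := reduce_blocks (ltnSn _) s2 n2 E.
right; exists r''; split=> //; last by rewrite f3.
  by apply: leq_trans s3 _.
by rewrite e3.
Qed.

End Reduction.

(** * The Ehrenfeucht-Fraisse game *)

Definition agree u v (N : nat) : Prop :=
  (forall r, size r <= N -> isSome (ev u r) = isSome (ev v r)) /\
  (forall r r' i i' j j', size r <= N -> size r' < N ->
    ev u r = Some (Some i) -> ev u r' = Some (Some i') ->
    ev v r = Some (Some j) -> ev v r' = Some (Some j') -> sameord i i' j j').

Lemma agree_sym u v N : agree u v N -> agree v u N.
Proof.
move=> [h1 h2]; split=> [r sr|r r' i i' j j' s1 s2 e1 e2 e3 e4].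
  by rewrite h1.
by rewrite sameord_swap; apply: (h2 r r').
Qed.

Lemma alt_equiv_agree u v n : fo2_alt_equiv #|Sigma|.+1 n u v -> agree u v n.
Proof.
move=> H; split=> [r sr|r r' i i' j j' s1 s2 e1 e2 e3 e4].
  case: (few_blocks H sr) => [[-> ->] //|[r' [_ _ _ _ /andP [h1 h2]]]].
  by rewrite h1 h2.
case: (few_blocks H s1) => [[]|[q [sq nq q1 q2 _]]]; first by rewrite e1.
case: (few_blocks H (ltnW s2)) => [[]|[q' [sq' nq' q1' q2' _]]].
  by rewrite e2.
(* Both reduced rankers have at most [#|Sigma|] blocks, which meets the strict bound required of the
   second one. *)
apply: (alt_equiv_ord (r := q) (r' := q') H);
  rewrite ?q1 ?q2 ?q1' ?q2' //.
- exact: leq_trans sq s1.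
- exact: leqW.
- exact: leq_ltn_trans sq' s2.
Qed.

(** Invariant for one pair of pebbles when [n] rounds remain; the relative order of the two pebbles
    is left to [position]. *)
Definition inv u v (n i j : nat) : Prop :=
  [/\ i < size u, onth u i = onth v j &
   forall r p q, size r <= n -> ev u r = Some (Some p) ->
     ev v r = Some (Some q) -> sameord p i q j].

Lemma inv_sym u v n i j : inv u v n i j -> inv v u n j i.
Proof.
move=> [h1 h2 h3]; split=> //.
  by have [a ha] := onth_lt_Some h1; apply: (@onth_Some_lt _ v j a); rewrite -h2.
by move=> r p q sr ep eq; rewrite sameord_swap; apply: (h3 r).
Qed.

Lemma inv_weak u v n i j : inv u v n.+1 i j -> inv u v n i j.
Proof.
by move=> [h1 h2 h3]; split=> // r p q sr; apply: h3; apply: leqW.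
Qed.

(** The value [p = None], given by the empty ranker, covers the case where no ranker of length at
    most [n] points to that side of [i]. *)
Definition nearest_ranker u (n i : nat) d r (p : option nat) : Prop :=
  [/\ size r <= n, ev u r = Some p, ltp d p i &
   forall r' p', size r' <= n -> ev u r' = Some (Some p') -> ltd d p' i ->
     exists2 p0, p = Some p0 & ~~ ltd d p0 p'].

Lemma nearest_ranker_exists u n i d : exists r p, nearest_ranker u n i d r p.
Proof.
pose P p := exists r, [/\ size r <= n, ev u r = Some (Some p) & ltd d p i].
case: (classic (exists p, P p)) => [exP|no].
  have [|p [[r [sr er pi]] mp]] := @nearest (~~ d) (size u) P _ exP.
    move=> p [[|[e a] r] [_ // er _]].
    by have [p0 [x [_ [->] /onth_Some_lt]]] := ev_cons er.
  exists r, (Some p); split=> // r' p' sr' er' p'i; exists p => //.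
  by rewrite -ltdN; apply: mp; exists r'.
exists [::], None; split=> // r' p' sr' er' p'i.
by case: no; exists p', r'.
Qed.

Section Game.
Variables (u v : seq Sigma) (N : nat).
Hypothesis A : agree u v N.

Lemma defined_right n r p : n <= N -> size r <= n -> ev u r = Some p ->
  exists q, ev v r = Some q.
Proof.
move=> nN sr er; have := A.1 r (leq_trans sr nN); rewrite er.
by case: (ev v r) => // q _; exists q.
Qed.

Lemma ltd_nearest n i' j' d s ps qs r p q : n < N ->
  nearest_ranker u n i' d s ps -> ev v s = Some qs -> ltp d qs j' ->
  size r <= n -> ev u r = Some (Some p) -> ev v r = Some (Some q) ->
  ltd d p i' -> ltd d q j'.
Proof.
move=> nN [ss es si ms] eqs qj sr er er' pi.
have [p0 eps np] := ms _ _ sr er pi; subst ps.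
have ne : s <> [::] by move=> e; move: es; rewrite e.
have [q0 eq0] := ev_position eqs ne; subst qs.
have so : sameord p p0 q q0.
  by apply: (A.2 r s) => //; [apply: leq_trans sr (ltnW nN)|apply: leq_ltn_trans nN].
move: np; rewrite sameordC in so; rewrite (sameord_ltd d so) => nq.
exact: nltd_ltd_trans nq qj.
Qed.

(** Each ranker of length at most [n] misses [i'] and is no closer to it than the nearest one on its
    side. By [agree] this order persists in [v], so it suffices to place [j'] between the images of
    the two nearest ones. *)
Lemma inv_between n i' j' d s ps qs t pt qt : n < N -> i' < size u ->
  onth u i' = onth v j' ->
  (forall r, size r <= n -> ev u r <> Some (Some i')) ->
  nearest_ranker u n i' d s ps -> ev v s = Some qs -> ltp d qs j' ->
  nearest_ranker u n i' (~~ d) t pt -> ev v t = Some qt -> ltp (~~ d) qt j' ->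
  inv u v n i' j'.
Proof.
move=> nN lti el nohit ns es qs1 nt et qt1; split=> // r p q sr ep eq.
have ne : p <> i' by move=> e; apply: (nohit r sr); rewrite ep e.
case: (boolP (ltd d p i')) => [pi|npi].
  apply: (@ltd_sameord d) => //.
  exact: (ltd_nearest nN ns es qs1 sr ep eq pi).
have pi : ltd (~~ d) p i' by rewrite ltdN; apply: ltd_total.
apply: (@ltd_sameord (~~ d)) => //.
exact: (ltd_nearest nN nt et qt1 sr ep eq pi).
Qed.

(* Duplicator answers a position named by a ranker with the same ranker.  Any
   other position is answered by stepping from the nearest ranker on one of its
   sides, the side chosen so that no other pebble lies in between. *)
Lemma respond n d i' (o : option (nat * nat)) : n < N -> i' < size u ->
  (if o is Some (i, j) then inv u v n.+1 i j /\ ltd d i i' else True) ->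
  exists j', inv u v n i' j' /\
    (if o is Some (i, j) then ltd d j j' : Prop else True).
Proof.
move=> nN lti ho.
have [a ha] := onth_lt_Some lti.
case: (classic (exists2 r, size r <= n & ev u r = Some (Some i'))).
  move=> [r sr er].
  have [q eq] := defined_right (ltnW nN) sr er.
  case: r sr er eq => [|[e b] r] // sr er eq.
  have [j' ej'] := ev_position eq (fun h => ltac:(discriminate h)); subst q.
  exists j'; split.
    split=> //.
      have [p0 [x [_ [<-] -> _ _]]] := ev_cons er.
      by have [q0 [y [_ [<-] -> _ _]]] := ev_cons eq.
    move=> r1 p q s1 ep eqq; apply: (A.2 r1 ((e, b) :: r)) => //.
      exact: leq_trans s1 (ltnW nN).
    exact: leq_ltn_trans nN.
  case: o ho => [[i j]|] // [[_ _ hi] ii'].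
  have so := hi _ _ _ (leqW sr) er eq.
  by rewrite -(sameord_ltd d (i := i) (i' := i')) // sameordC.
move=> nohit'.
have nohit r : size r <= n -> ev u r <> Some (Some i').
  by move=> sr er; apply: nohit'; exists r.
have [s [ps ns]] := nearest_ranker_exists u n i' d.
have [t [pt nt]] := nearest_ranker_exists u n i' (~~ d).
have [ss es si ms] := ns; have [st et ti mt] := nt.
have [qs es'] := defined_right (ltnW nN) ss es.
have [qt et'] := defined_right (ltnW nN) st et.
(* First case: the other pebble [i] lies between [s] and [i']. Seen from [i], the step back from [t]
   stops at or beyond [i']; the resulting ranker has length at most [n + 1], which the invariant for
   [(i, j)] still covers. *)
case: (classic (if o is Some (i, j) then ltp d ps i : Prop else False)).
  case: o ho => [[i j]|] // [[lti0 el0 hi] ii'] psi.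
  have [p'' ep''] := ev_defined et ha ti.
  have szt : size ((~~ d, a) :: t) <= n.+1 by [].
  have [q1 eq''] := defined_right nN szt ep''.
  have [q0 [q'' [eq0 eq1 hq'' qt'' _]]] := ev_cons eq''; subst q1.
  have [p0 [p1 [ep0 ep1 _ _ mp]]] := ev_cons ep''; case: ep1 => ep1; subst p1.
  move: ep0 eq0 mp qt''; rewrite et et' => -[<-] [<-] mp qt''.
  have np := mp _ ha ti; rewrite ltdN in np.
  have ip : ltd d i p'' by apply: ltd_nltd_trans ii' np.
  have jq : ltd d j q''.
    have so := hi _ _ _ szt ep'' eq''; rewrite sameordC in so.
    by rewrite -(sameord_ltd d so).
  exists q''; split=> //.
  apply: (inv_between nN lti _ nohit ns es' _ nt et' qt''); first by rewrite ha.
  case: qs es' => [q|] //= es'.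
  have ne : s <> [::] by move=> e; move: es'; rewrite e.
  have [p e] := ev_position es ne; subst ps.
  have so := hi _ _ _ (leqW ss) es es'.
  by apply: ltd_trans jq; rewrite -(sameord_ltd d so).
(* Now [i] is absent or not beyond [s], so a step forward from [s] clears it. That the answer stays
   before [t] follows from [agree], applied to lengths at most [n + 1] and [n]. *)
move=> nb0.
have [p'' ep''] := ev_defined es ha si.
have szs : size ((d, a) :: s) <= n.+1 by [].
have [q1 eq''] := defined_right nN szs ep''.
have [q0 [q'' [eq0 eq1 hq'' qs'' _]]] := ev_cons eq''; subst q1.
have [p0 [p1 [ep0 ep1 _ _ mp]]] := ev_cons ep''; case: ep1 => ep1; subst p1.
move: ep0 eq0 mp qs''; rewrite es es' => -[<-] [<-] mp qs''.
have np := mp _ ha si.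
exists q''; split.
  apply: (inv_between nN lti _ nohit ns es' qs'' nt et' _); first by rewrite ha.
  case: qt et' => [q|] //= et'.
  have ne : t <> [::] by move=> e; move: et'; rewrite e.
  have [p e] := ev_position et ne; subst pt.
  have so : sameord p'' p q'' q.
    by apply: (A.2 ((d, a) :: s) t) => //; apply: leq_ltn_trans nN.
  rewrite ltdN -(sameord_ltd d so).
  by move: ti; rewrite /= ltdN; apply: nltd_ltd_trans.
case: o ho nb0 => [[i j]|] // [[lti0 el0 hi] ii'] /negP nb0.
case: ps es nb0 {ns ms si mp} => [p|] //= es npi.
have ne : s <> [::] by move=> e; move: es; rewrite e.
have [q e] := ev_position es' ne; subst qs.
have so := hi _ _ _ (leqW ss) es es'.
move: npi; rewrite (sameord_ltd d so) => nq.
exact: nltd_ltd_trans nq qs''.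
Qed.

(** [X] marks the variables whose pebbles are placed; the values of the others are arbitrary. *)
Definition position (n : nat) (X : var -> bool) (s s' : asg) : Prop :=
  (forall z, X z -> inv u v n (getv s z) (getv s' z)) /\
  (X VX -> X VY -> sameord s.1 s.2 s'.1 s'.2).

Lemma position_step n X s s' z i : n < N -> position n.+1 X s s' ->
  i < size u -> exists2 j, j < size v &
  position n (fun y => (y == z) || X y) (setv s z i) (setv s' z j).
Proof.
move=> nN [hX hO] lti.
suff [j [hj ho]] : exists j, inv u v n i j /\
    (X (other z) -> sameord (getv s (other z)) i (getv s' (other z)) j).
  exists j; first by have [] := inv_sym hj.
  split=> [y|]; last by case: z ho {hj} => /= ho h1 h2;
    [rewrite sameordC|]; apply: ho; rewrite ?orbT.
  case: (eqVneq y z) => [->|ne] /= hy; first by rewrite !getv_set.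
  have ez : z = other y by case: (y) ne; case: (z).
  by rewrite ez !getv_other; apply: inv_weak; apply: hX.
case hz: (X (other z)); last first.
  by have [j [hj _]] := @respond n true i None nN lti I; exists j.
have hi := hX _ hz.
case: (eqVneq (getv s (other z)) i) => [e|ne].
  exists (getv s' (other z)); split=> [|_]; last by rewrite e /sameord !ltnn.
  by rewrite -e; apply: inv_weak.
pose d := getv s (other z) < i.
have ld : ltd d (getv s (other z)) i by rewrite /d /ltd; case: ltnP; lia.
have [j [hj lj]] := @respond n d i (Some (_, _)) nN lti (conj hi ld).
by exists j; split=> // _; apply: (@ltd_sameord d).
Qed.

End Game.

Lemma position_sym u v n X s s' : position u v n X s s' ->
  position v u n X s' s.
Proof.
move=> [h1 h2]; split=> [z hz|hx hy]; first by apply: inv_sym; apply: h1.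
by rewrite sameord_swap; apply: h2.
Qed.

Lemma agree_sat u v N n (X : var -> bool) s s' (f : form Sigma) :
  agree u v N -> n <= N -> qdepth f <= n -> (forall z, free_in z f -> X z) -> position u v n X s s' ->
  sat u s f <-> sat v s' f.
Proof.
move=> A; have A' := agree_sym A.
have atom_letter (s1 s1' : asg) a z (X1 : var -> bool) m :
    X1 z -> position u v m X1 s1 s1' ->
    (onth u (getv s1 z) = Some a) <-> (onth v (getv s1' z) = Some a).
  by move=> hz [h _]; have [_ -> _] := h z hz.
have atom_ord (s1 s1' : asg) z z' (X1 : var -> bool) m : X1 z -> X1 z' ->
    position u v m X1 s1 s1' ->
    sameord (getv s1 z) (getv s1 z') (getv s1' z) (getv s1' z').
  move=> hz hz' [_ h]; case: z hz; case: z' hz' => hz' hz /=;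
    rewrite /sameord ?ltnn //; last rewrite andbC; exact: h.
elim: f n X s s' => [||a z|a z|z z'|z z'|z z'|z z'|f IHf g IHg|f IHf g IHg
  |z f IH|z f IH] n X s s' nN qd hfr hp //=.
- by apply: atom_letter hp; apply: hfr => /=.
- by rewrite (atom_letter s s' a z X n) //; apply: hfr => /=.
- have := atom_ord s s' z z' X n (hfr _ _) (hfr _ _) hp.
  by rewrite /= !eqxx orbT => /(_ isT isT); rewrite /sameord; lia.
- have := atom_ord s s' z z' X n (hfr _ _) (hfr _ _) hp.
  by rewrite /= !eqxx orbT => /(_ isT isT); rewrite /sameord; lia.
- have := atom_ord s s' z z' X n (hfr _ _) (hfr _ _) hp.
  by rewrite /= !eqxx orbT => /(_ isT isT); rewrite /sameord; lia.
- have := atom_ord s s' z z' X n (hfr _ _) (hfr _ _) hp.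
  by rewrite /= !eqxx orbT => /(_ isT isT); rewrite /sameord; lia.
- move: qd; rewrite /= geq_max => /andP [qf qg].
  rewrite (IHf n X s s') // ?(IHg n X s s') // => y hy; apply: hfr;
    by rewrite /= hy ?orbT.
- move: qd; rewrite /= geq_max => /andP [qf qg].
  rewrite (IHf n X s s') // ?(IHg n X s s') // => y hy; apply: hfr;
    by rewrite /= hy ?orbT.
- case: n nN qd hp => // n nN qd hp.
  have hfr' y : free_in y f -> (y == z) || X y.
    by move=> hy; case: (eqVneq y z) => //= ne; apply: hfr; rewrite /= eq_sym ne.
  split=> [[i [lti hi]]|[j [ltj hj]]].
    have [j ltj hp'] := position_step A z nN hp lti.
    by exists j; split=> //; apply/(IH n _ _ _ (ltnW nN) qd hfr' hp').
  have [i lti /position_sym hp'] := position_step A' z nN (position_sym hp) ltj.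
  by exists i; split=> //; apply/(IH n _ _ _ (ltnW nN) qd hfr' hp').
- case: n nN qd hp => // n nN qd hp.
  have hfr' y : free_in y f -> (y == z) || X y.
    by move=> hy; case: (eqVneq y z) => //= ne; apply: hfr; rewrite /= eq_sym ne.
  split=> [h j ltj|h i lti].
    have [i lti /position_sym hp'] := position_step A' z nN (position_sym hp) ltj.
    by apply/(IH n _ _ _ (ltnW nN) qd hfr' hp'); apply: h.
  have [j ltj hp'] := position_step A z nN hp lti.
  by apply/(IH n _ _ _ (ltnW nN) qd hfr' hp'); apply: h.
Qed.

End Sentences.

Theorem theorem4p7 (Sigma : finType) (u v : seq Sigma) (n : nat) :
  fo2_alt_equiv (#|Sigma|.+1) n u v -> fo2_equiv n u v.
Proof.
move=> /alt_equiv_agree A f /andP [nx ny] qf.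
(* A sentence starts with no pebble placed, so [position] holds vacuously. *)
apply: (@agree_sat _ u v n n (fun=> false)) => //.
by case; rewrite ?(negbTE nx) ?(negbTE ny).
Qed.
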